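(* Let $c=(c_1,c_2)$ be a real vector and $D=(d_{ij})$ a real positive semi-definite $2\times 2$ matrix, and consider the equation $$\frac{\partial u}{\partial t}=d_{11}u_{xx}+(d_{12}+d_{21})u_{xy}+d_{22}u_{yy}+c_1u_x+c_2u_y$$ on the unit square $[0,1]\times[0,1]$ with periodic boundary condition. Let the semi-discrete system $U'(t)=(A_0+A_1+A_2)U(t)$, with splitting $F_j(t,v)=A_jv$ ($j=0,1,2$), be obtained by the finite difference discretization and splitting described in the context, with any real $\beta\in[-1,1]$. Then the Modified Craig--Sneyd (MCS) scheme with parameter $\theta$ is unconditionally stable when applied to this split semi-discrete system whenever $\frac12\le\theta\le 1$. Moreover, this conclusion remains valid when any other stable finite difference discretizations for $u_x$, $u_y$ are used in place of the central ones.
   Context: Positive semi-definite means $\xi^{T}D\xi\ge 0$ for all $\xi\in\mathbb{R}^2$; the coefficients $c,D$ are constant. Discretization. On a uniform periodic Cartesian grid with $m_1$, $m_2$ points and mesh widths $\Delta x$, $\Delta y$ in the $x$ and $y$ directions (indices $i,j$ taken modulo $m_1,m_2$), with $u_{i,j}=u(i\Delta x,j\Delta y,t)$, use $$(u_x)_{i,j}\approx\frac{u_{i+1,j}-u_{i-1,j}}{2\Delta x},\qquad (u_y)_{i,j}\approx\frac{u_{i,j+1}-u_{i,j-1}}{2\Delta y},$$ $$(u_{xx})_{i,j}\approx\frac{u_{i+1,j}-2u_{i,j}+u_{i-1,j}}{(\Delta x)^2},\qquad (u_{yy})_{i,j}\approx\frac{u_{i,j+1}-2u_{i,j}+u_{i,j-1}}{(\Delta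 y)^2},$$ $$(u_{xy})_{i,j}\approx\frac{(1+\beta)(u_{i+1,j+1}+u_{i-1,j-1})-(1-\beta)(u_{i-1,j+1}+u_{i+1,j-1})}{4\Delta x\Delta y}+\frac{4\beta u_{i,j}-2\beta(u_{i+1,j}+u_{i,j+1}+u_{i-1,j}+u_{i,j-1})}{4\Delta x\Delta y},$$ where $\beta$ is a real parameter with $-1\le\beta\le1$. Splitting. $A_0$ is the matrix of the discretized mixed derivative term $(d_{12}+d_{21})u_{xy}$, $A_1$ that of $d_{11}u_{xx}+c_1u_x$, and $A_2$ that of $d_{22}u_{yy}+c_2u_y$. These matrices are normal and commute, and are simultaneously diagonalized by the discrete Fourier modes. MCS scheme. For $U'(t)=F(t,U(t))$ with $F=F_0+F_1+F_2$, time step $\Delta t>0$, $t_n=n\Delta t$ and parameter $\theta>0$, the approximation $U_n\approx U(t_n)$ is obtained from $U_{n-1}$ by $$\begin{aligned} Y_0&=U_{n-1}+\Delta t\,F(t_{n-1},U_{n-1}),\\ Y_j&=Y_{j-1}+\theta\Delta t\,(F_j(t_n,Y_j)-F_j(t_{n-1},U_{n-1}))\quad(j=1,2),\\ \widehat Y_0&=Y_0+\theta\Delta t\,(F_0(t_n,Y_2)-F_0(t_{n-1},U_{n-1})),\\ \widetilde Y_0&=\widehat Y_0+(\tfrac12-\theta)\Delta t\,(F(t_n,Y_2)-F(t_{n-1},U_{n-1})),\\ \widetilde Y_j&=\widetilde Y_{j-1}+\theta\Delta t\,(F_j(t_n,\widetilde Y_j)-F_j(t_{n-1},U_{n-1}))\quad(j=1,2),\\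 U_n&=\widetilde Y_2. \end{aligned}$$ Applied to the scalar equation $U'=(\lambda_0+\lambda_1+\lambda_2)U$ (with $F_j(t,v)=\lambda_j v$) it gives $U_n=S_\theta(z_0,z_1,z_2)U_{n-1}$ with $z_j=\Delta t\,\lambda_j$, where, with $z=z_1+z_2$ and $p=(1-\theta z_1)(1-\theta z_2)$, $$S_\theta(z_0,z_1,z_2)=1+\frac{z_0+z}{p}+\theta\frac{z_0(z_0+z)}{p^2}+(\tfrac12-\theta)\frac{(z_0+z)^2}{p^2}.$$ Unconditional stability (in the von Neumann sense) means: for all $\Delta t>0$ and all mesh widths $\Delta x,\Delta y$ (grid sizes $m_1,m_2$), one has $|S_\theta(\Delta t\lambda_0,\Delta t\lambda_1,\Delta t\lambda_2)|\le1$ for every triple $(\lambda_0,\lambda_1,\lambda_2)$ of eigenvalues of $A_0,A_1,A_2$ belonging to a common discrete Fourier mode. A stable finite difference discretization of $u_x$ (in the term $c_1u_x$) is a constant-coefficient linear finite difference formula on the periodic grid, involving grid points in the $x$ direction only, such that all eigenvalues of the resulting matrix for the term $c_1u_x$ have nonpositive real part; similarly for $u_y$ in the term $c_2u_y$, with grid points in the $y$ direction only. *)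

(* Defs.v *)
From HB Require Import structures.
From mathcomp Require Import all_boot all_order all_algebra.
From mathcomp Require Import complex.
From mathcomp Require Import all_classical all_reals all_analysis.
From mathcomp Require Import ring.

Set Implicit Arguments.
Unset Strict Implicit.
Unset Printing Implicit Defensive.

Import Order.TTheory GRing.Theory Num.Theory.
Local Open Scope ring_scope.

(* D is not assumed to be symmetric. *)
Definition psd (R : realType) (D : 'M[R]_2) : Prop :=
  forall xi : 'cV[R]_2, 0 <= (xi^T *m D *m xi) 0 0.

(* The index i + s modulo m; [ordS] and [ord_pred] are the cyclic successor and
   predecessor on 'I_m. *)
Definition pshift (m : nat) (s : int) (i : 'I_m) : 'I_m :=
  match s with
  | Posz n => iter n (@ordS m) i
  | Negz n => iter n.+1 (@ord_pred m) i
  end.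

Lemma pshiftE (m : nat) (s : int) (i : 'I_m) :
  (pshift s i)%:Z = ((i%:Z + s) %% m%:Z)%Z.
Proof.
have succE (j : 'I_m) : (ordS j)%:Z = ((j%:Z + 1) %% m%:Z)%Z.
  by rewrite /= -modz_nat -addn1 PoszD.
have predE (j : 'I_m) : (ord_pred j)%:Z = ((j%:Z - 1) %% m%:Z)%Z.
  case: m i {succE} j => [[//]|m] i j /=.
  rewrite -modz_nat addnS /= PoszD -[RHS](modzDr _ m.+1); congr (_ %% _)%Z.
  have -> : Posz m.+1 = m%:Z + 1 by rewrite -addn1 PoszD.
  by ring.
rewrite /pshift; case: s => n; elim: n => [|n IH].
- by rewrite /= addr0 modz_small // ltz_nat ltn_ord.
- rewrite iterS succE IH modzDml; congr (_ %% _)%Z.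
  by rewrite -[n.+1]addn1 PoszD; ring.
- by rewrite (_ : iter 1 _ i = ord_pred i) // predE NegzE.
rewrite iterS predE IH modzDml; congr (_ %% _)%Z.
by rewrite !NegzE -[n.+2]addn1 PoszD; ring.
Qed.

(* Mesh width of the uniform periodic grid with m points on [0,1]. *)
Definition mesh (R : realType) (m : nat) : R := m%:R^-1.

(* A constant-coefficient linear difference formula in one variable for a first
   derivative: on the m-point grid, (v')_i is replaced by the sum of
   w * v_{i+s} over the pairs (s, w) of the list.  The list depends on m, which
   accounts for the dependence of the coefficients on the mesh width. *)
Definition stencil (R : realType) : Type := nat -> seq (int * R).

Definition central (R : realType) : stencil R := fun m =>
  [:: (1, (2 * mesh R m)^-1); (-1, - (2 * mesh R m)^-1)].

(* A grid function u is the m1 x m2 matrix of its values u_{i,j}. *)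
Definition Dx (R : realType) (w : stencil R) (m1 m2 : nat)
    (u : 'M[R]_(m1, m2)) : 'M[R]_(m1, m2) :=
  \matrix_(i, j) \sum_(p <- w m1) p.2 * u (pshift p.1 i) j.

Definition Dy (R : realType) (w : stencil R) (m1 m2 : nat)
    (u : 'M[R]_(m1, m2)) : 'M[R]_(m1, m2) :=
  \matrix_(i, j) \sum_(p <- w m2) p.2 * u i (pshift p.1 j).

Lemma Dx_centralE (R : realType) (m1 m2 : nat) (u : 'M[R]_(m1, m2)) i j :
  Dx (@central R) u i j = (u (ordS i) j - u (ord_pred i) j) / (2 * mesh R m1).
Proof. by rewrite !mxE !big_cons big_nil /=; ring. Qed.

Lemma Dy_centralE (R : realType) (m1 m2 : nat) (u : 'M[R]_(m1, m2)) i j :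
  Dy (@central R) u i j = (u i (ordS j) - u i (ord_pred j)) / (2 * mesh R m2).
Proof. by rewrite !mxE !big_cons big_nil /=; ring. Qed.

Definition Dxx (R : realType) (m1 m2 : nat)
    (u : 'M[R]_(m1, m2)) : 'M[R]_(m1, m2) :=
  \matrix_(i, j)
    ((u (ordS i) j - 2 * u i j + u (ord_pred i) j) / mesh R m1 ^+ 2).

Definition Dyy (R : realType) (m1 m2 : nat)
    (u : 'M[R]_(m1, m2)) : 'M[R]_(m1, m2) :=
  \matrix_(i, j)
    ((u i (ordS j) - 2 * u i j + u i (ord_pred j)) / mesh R m2 ^+ 2).

Definition Dxy (R : realType) (beta : R) (m1 m2 : nat)
    (u : 'M[R]_(m1, m2)) : 'M[R]_(m1, m2) :=
  \matrix_(i, j)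
    (((1 + beta) * (u (ordS i) (ordS j) + u (ord_pred i) (ord_pred j))
      - (1 - beta) * (u (ord_pred i) (ordS j) + u (ordS i) (ord_pred j)))
       / (4 * mesh R m1 * mesh R m2)
     + (4 * beta * u i j
        - 2 * beta * (u (ordS i) j + u i (ordS j)
                      + u (ord_pred i) j + u i (ord_pred j)))
       / (4 * mesh R m1 * mesh R m2)).

(* [lin_mx f] is the matrix of the linear map f in MathComp's row-vector
   convention: mxvec u *m lin_mx f = mxvec (f u).  Eigenvectors are thus row
   vectors throughout. *)
Definition A0 (R : realType) (beta : R) (D : 'M[R]_2) (m1 m2 : nat) :
    'M[R]_(m1 * m2) :=
  lin_mx (fun u : 'M[R]_(m1, m2) => (D 0 1 + D 1 0) *: Dxy beta u).

Definition A1 (R : realType) (c : 'cV[R]_2) (D : 'M[R]_2) (wx : stencil R)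
    (m1 m2 : nat) : 'M[R]_(m1 * m2) :=
  lin_mx (fun u : 'M[R]_(m1, m2) => D 0 0 *: Dxx u + c 0 0 *: Dx wx u).

Definition A2 (R : realType) (c : 'cV[R]_2) (D : 'M[R]_2) (wy : stencil R)
    (m1 m2 : nat) : 'M[R]_(m1 * m2) :=
  lin_mx (fun u : 'M[R]_(m1, m2) => D 1 1 *: Dyy u + c 1 0 *: Dy wy u).

Definition convection_x (R : realType) (c : 'cV[R]_2) (wx : stencil R)
    (m1 m2 : nat) : 'M[R]_(m1 * m2) :=
  lin_mx (fun u : 'M[R]_(m1, m2) => c 0 0 *: Dx wx u).

Definition convection_y (R : realType) (c : 'cV[R]_2) (wy : stencil R)
    (m1 m2 : nat) : 'M[R]_(m1 * m2) :=
  lin_mx (fun u : 'M[R]_(m1, m2) => c 1 0 *: Dy wy u).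

Definition complexify (R : realType) (n : nat) (A : 'M[R]_n) : 'M[R[i]]_n :=
  map_mx (real_complex R) A.

Definition stable_discretization (R : realType)
    (C : forall m1 m2 : nat, 'M[R]_(m1 * m2)) : Prop :=
  forall m1 m2 : nat, (0 < m1)%N -> (0 < m2)%N ->
  forall a : R[i], eigenvalue (complexify (C m1 m2)) a -> complex.Re a <= 0.

Definition cis (R : realType) (t : R) : R[i] := Complex (cos t) (sin t).

Definition fourier (R : realType) (m1 m2 : nat) (k : 'I_m1) (l : 'I_m2) :
    'M[R[i]]_(m1, m2) :=
  \matrix_(i, j)
    cis (2 * pi * (k%:R * i%:R / m1%:R + l%:R * j%:R / m2%:R)).

(* lambda is the eigenvalue of A belonging to the Fourier mode (k, l), which is
   a nonzero vector. *)
Definition mode_eigenvalue (R : realType) (m1 m2 : nat)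
    (A : 'M[R]_(m1 * m2)) (k : 'I_m1) (l : 'I_m2) (lambda : R[i]) : Prop :=
  mxvec (fourier R k l) *m complexify A = lambda *: mxvec (fourier R k l).

(* One step of the MCS scheme from time t to t + dt, from u to v.  The stages
   are implicit, hence the relational form. *)
Definition MCS_step (K : fieldType) (V : lmodType K) (F0 F1 F2 : K -> V -> V)
    (theta dt t : K) (u v : V) : Prop :=
  let t' := t + dt in
  let F s w := F0 s w + F1 s w + F2 s w in
  exists Y0 Y1 Y2 Yh Z0 Z1 Z2 : V,
    Y0 = u + dt *: F t u /\
    Y1 = Y0 + (theta * dt) *: (F1 t' Y1 - F1 t u) /\
    Y2 = Y1 + (theta * dt) *: (F2 t' Y2 - F2 t u) /\
    Yh = Y0 + (theta * dt) *: (F0 t' Y2 - F0 t u) /\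
    Z0 = Yh + ((2^-1 - theta) * dt) *: (F t' Y2 - F t u) /\
    Z1 = Z0 + (theta * dt) *: (F1 t' Z1 - F1 t u) /\
    Z2 = Z1 + (theta * dt) *: (F2 t' Z2 - F2 t u) /\
    v = Z2.

Definition MCS_p (K : fieldType) (theta z1 z2 : K) : K :=
  (1 - theta * z1) * (1 - theta * z2).

Definition MCS_S (K : fieldType) (theta z0 z1 z2 : K) : K :=
  let z := z1 + z2 in
  let p := MCS_p theta z1 z2 in
  1 + (z0 + z) / p + theta * (z0 * (z0 + z) / p ^+ 2)
    + (2^-1 - theta) * ((z0 + z) ^+ 2 / p ^+ 2).

Lemma MCS_step_scalar (K : fieldType) (l0 l1 l2 theta dt t u v : K) :
  MCS_p theta (dt * l1) (dt * l2) != 0 ->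
  @MCS_step K K^o (fun _ w => l0 * w) (fun _ w => l1 * w) (fun _ w => l2 * w)
    theta dt t u v <->
  v = MCS_S theta (dt * l0) (dt * l1) (dt * l2) * u.
Proof.
rewrite /MCS_p mulf_eq0 negb_or => /andP[p1 p2].
have solve (q a b y : K) : 1 - theta * (dt * q) != 0 ->
    y = a + theta * dt * (q * y - b)
    <-> y = (a - theta * dt * b) / (1 - theta * (dt * q)).
  move=> hq; split=> [e|->]; last by field.
  by apply: (mulIf hq); rewrite divfK // {1}mulrBr mulr1 {1}e; ring.
rewrite /MCS_step /MCS_S /MCS_p /= /GRing.scale /=.
move: (2^-1 : K) => h; split.
  move=> [Y0 [Y1 [Y2 [Yh [Z0 [Z1 [Z2 [e0 [e1 [e2 [eh [f0 [f1 [f2 ->]]]]]]]]]]]]]].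
  have {}e1 := (solve _ _ _ _ p1).1 e1.
  have {}e2 := (solve _ _ _ _ p2).1 e2.
  have {}f1 := (solve _ _ _ _ p1).1 f1.
  have {}f2 := (solve _ _ _ _ p2).1 f2.
  by rewrite f2 f1 f0 eh e2 e1 e0; field; rewrite p2 p1.
move=> ->.
pose Y0 := u + dt * (l0 * u + l1 * u + l2 * u).
pose Y1 := (Y0 - theta * dt * (l1 * u)) / (1 - theta * (dt * l1)).
pose Y2 := (Y1 - theta * dt * (l2 * u)) / (1 - theta * (dt * l2)).
pose Yh := Y0 + theta * dt * (l0 * Y2 - l0 * u).
pose Z0 := Yh + (h - theta) * dt *
  (l0 * Y2 + l1 * Y2 + l2 * Y2 - (l0 * u + l1 * u + l2 * u)).
pose Z1 := (Z0 - theta * dt * (l1 * u)) / (1 - theta * (dt * l1)).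
pose Z2 := (Z1 - theta * dt * (l2 * u)) / (1 - theta * (dt * l2)).
exists Y0, Y1, Y2, Yh, Z0, Z1, Z2; do !split => //; try exact/solve.
by rewrite /Z2 /Z1 /Z0 /Yh /Y2 /Y1 /Y0; field; rewrite p1 p2.
Qed.

(* Von Neumann stability.  Division by zero yields zero in MathComp, so the
   requirement that the amplification factor is well defined, i.e. that its
   denominator does not vanish, is made explicit. *)
Definition MCS_unconditionally_stable (R : realType) (theta : R)
    (B0 B1 B2 : forall m1 m2 : nat, 'M[R]_(m1 * m2)) : Prop :=
  forall m1 m2 : nat, (0 < m1)%N -> (0 < m2)%N ->
  forall dt : R, 0 < dt ->
  forall (k : 'I_m1) (l : 'I_m2) (l0 l1 l2 : R[i]),
    mode_eigenvalue (B0 m1 m2) k l l0 ->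
    mode_eigenvalue (B1 m1 m2) k l l1 ->
    mode_eigenvalue (B2 m1 m2) k l l2 ->
    MCS_p theta%:C%C (dt%:C%C * l1) (dt%:C%C * l2) != 0 /\
    `|MCS_S theta%:C%C (dt%:C%C * l0) (dt%:C%C * l1) (dt%:C%C * l2)| <= 1.

(* Main.v *)
(* On the Fourier mode with angles x and y, z0 is real, and |beta| <= 1 together
   with the positive semi-definiteness of D gives z0^2 <= 4 Re z1 Re z2, where
   Re z1, Re z2 <= 0.  Put a = 1 - theta z1, b = 1 - theta z2, t = 1/theta,
   g = (2/a - 1)(2/b - 1) and e = 2 theta z0 / (a b).  Since
   1 - |2/a - 1|^2 = 4 (Re a - 1) / |a|^2, the condition on z0 becomes
   |g| + |e| <= 1, while
     8 S = 8 - 4t (1 - g - e) - 2t (1 - g - e)(1 - g) + t^2 (1 - g - e)^2.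
   For 1 <= t <= 2 the only negative coefficient of this polynomial in g and e is
   that of g^2, and a direct estimate shows that its modulus is nevertheless
   largest at nonnegative real g and e, where 8 S <= 8. *)
Require Import Defs.
From HB Require Import structures.
From mathcomp Require Import all_boot all_order all_algebra.
From mathcomp Require Import complex.
From mathcomp Require Import all_classical all_reals all_analysis.
From mathcomp Require Import ring lra.
Import Order.TTheory GRing.Theory Num.Theory.
Local Open Scope ring_scope.

Import ComplexField.Normc.

(** * Moduli of complex numbers and the bound on the amplification factor *)

Lemma normc_sqr (R : rcfType) (z : R[i]) :
  normc z ^+ 2 = complex.Re z ^+ 2 + complex.Im z ^+ 2.
Proof. by case: z => x y /=; rewrite sqr_sqrtr // addr_ge0 ?sqr_ge0. Qed.

Lemma normc_ge0 (R : rcfType) (z : R[i]) : 0 <= normc z.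
Proof. by case: z => x y; apply: sqrtr_ge0. Qed.

Lemma normc_real (R : rcfType) (x : R) : 0 <= x -> normc x%:C%C = x.
Proof. by move=> x0; rewrite /= expr0n addr0 sqrtr_sqr ger0_norm. Qed.

(** With r = |g| and x = Re g, the difference of the squared sides has the factor r - x, so equality
    holds at nonnegative real g. The relation between [A], [B] and [s] cancels the part of the
    cofactor without an evident sign; what is left is nonnegative for r <= 1. *)
Lemma normc_quadratic_le (R : rcfType) (A B s : R) (g : R[i]) :
  0 <= A -> 0 <= s <= B -> B * (A - s) = 4 * A * s -> normc g <= 1 ->
  normc (A%:C%C + B%:C%C * g - s%:C%C * g ^+ 2) <=
    A + B * normc g - s * normc g ^+ 2.
Proof.
move=> A0 /andP[s0 sB] ABs; have := normc_sqr _ g; have := normc_ge0 _ g.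
move: (normc g) => r r0 r2 r1.
have xr : complex.Re g <= r.
  by apply: (le_trans (ler_norm _)); rewrite -ler_sqr ?nnegrE // real_normK
    ?num_real // r2 lerDl sqr_ge0.
have rr : r ^+ 2 <= r by rewrite expr2 ler_piMl.
(* Nonnegativity of the right-hand side allows comparing squares. *)
have rhs0 : 0 <= A + B * r - s * r ^+ 2.
  have : s * r ^+ 2 <= B * r by apply: ler_pM => //; apply: sqr_ge0.
  lra.
rewrite -ler_sqr ?nnegrE ?normc_ge0 //.
case: g r2 xr => x y /= r2 xr.
have -> : normc (A%:C%C + B%:C%C * (x +i* y)%C - s%:C%C * (x +i* y)%C ^+ 2) ^+ 2
    = (A + B * x - s * (x ^+ 2 - y ^+ 2)) ^+ 2 + y ^+ 2 * (B - 2 * s * x) ^+ 2.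
  by rewrite normc_sqr /=; ring.
have -> : y ^+ 2 = r ^+ 2 - x ^+ 2 by lra.
rewrite -subr_ge0.
have -> : (A + B * r - s * r ^+ 2) ^+ 2 -
    ((A + B * x - s * (x ^+ 2 - (r ^+ 2 - x ^+ 2))) ^+ 2
      + (r ^+ 2 - x ^+ 2) * (B - 2 * s * x) ^+ 2) =
  2 * (r - x) * (B * (A - s) - 4 * A * s
    + 2 * A * s * (r - x) + 4 * A * s * (1 - r) + B * s * (1 - r ^+ 2)) by ring.
rewrite ABs subrr add0r.
have B0 : 0 <= B := le_trans s0 sB.
have rx : 0 <= r - x by rewrite subr_ge0.
have r1' : 0 <= 1 - r by rewrite subr_ge0.
have rr1 : 0 <= 1 - r ^+ 2 by rewrite subr_ge0 (le_trans rr).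
by do ?[done | apply: mulr_ge0 | apply: addr_ge0].
Qed.

(** The part free of [e] is bounded by [normc_quadratic_le] and the rest by the triangle inequality,
    which reduces the claim to the real numbers |g| and |e|. *)
Lemma MCS_disk_le (R : rcfType) (t : R) (g e : R[i]) :
  1 <= t <= 2 -> normc g + normc e <= 1 ->
  normc (1 - t%:C%C / 2 * (1 - g - e) * (1 + (1 - g) / 2)
    + t%:C%C ^+ 2 / 8 * (1 - g - e) ^+ 2) <= 1.
Proof.
move=> /andP[t1 t2] ge1.
have g0 := normc_ge0 _ g; have e0 := normc_ge0 _ e.
(* In 8 S the coefficients of 1, g and g^2 are [A], [B] and [- s]; both sides of B (A - s) = 4 A s
   equal 4 t (4 - t) (2 - t)^2. *)
pose s := t * (2 - t).
pose A := (2 - t) * (4 - t).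
pose B := 2 * t * (4 - t).
have s0 : 0 <= s by rewrite mulr_ge0; lra.
have A0 : 0 <= A by rewrite mulr_ge0; lra.
have sB : s <= B by rewrite /s /B; nra.
have gq : normc (A%:C%C + B%:C%C * g - s%:C%C * g ^+ 2) <=
    A + B * normc g - s * normc g ^+ 2.
  by apply: normc_quadratic_le; rewrite ?s0 // /A /B /s; [ring|lra].
(* The cofactor of [e] in 8 S; its coefficients are nonnegative for 1 <= t <= 2. *)
pose w := (2 * t * (3 - t))%:C%C + (t ^+ 2)%:C%C * e + (2 * t * (t - 1))%:C%C * g.
have wq : normc w <=
    2 * t * (3 - t) + t ^+ 2 * normc e + 2 * t * (t - 1) * normc g.
  apply: le_trans (le_normcD _ _) _; apply: lerD; last first.
    by rewrite normcM normc_real // !mulr_ge0; lra.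
  apply: le_trans (le_normcD _ _) _; apply: lerD; last first.
    by rewrite normcM normc_real // sqr_ge0.
  by rewrite normc_real // !mulr_ge0; lra.
have -> : 1 - t%:C%C / 2 * (1 - g - e) * (1 + (1 - g) / 2)
    + t%:C%C ^+ 2 / 8 * (1 - g - e) ^+ 2 =
  (8^-1)%:C%C * (A%:C%C + B%:C%C * g - s%:C%C * g ^+ 2 + e * w).
  rewrite /A /B /s /w !(rmorphM, rmorphB, rmorphXn, fmorphV, rmorph1, rmorph_nat) /=.
  by field.
rewrite normcM normc_real ?invr_ge0 //.
rewrite mulrC ler_pdivrMr // mul1r.
apply: le_trans (le_normcD _ _) _; rewrite normcM.
apply: le_trans (lerD gq (ler_wpM2l e0 wq)) _.
move: (normc g) (normc e) g0 e0 ge1 => r q r0 q0 rq.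
rewrite -subr_ge0.
(* The real polynomial equals 8 on the line r + q = 1, hence the factor 1 - r - q. *)
have -> : 8 - (A + B * r - s * r ^+ 2
    + q * (2 * t * (3 - t) + t ^+ 2 * q + 2 * t * (t - 1) * r))
  = (1 - r - q) * (4 * t + 2 * t * q + s * (1 - r - q)).
  by rewrite /A /B /s; ring.
have x0 : 0 <= 1 - r - q by lra.
have t0 : 0 <= t by lra.
by do ?[done | apply: mulr_ge0 | apply: addr_ge0].
Qed.

(** This is |2 - a|^2 = |a|^2 - 4 (Re a - 1) divided by |a|^2. For a = 1 - theta z the quotient is
    the Cayley transform (1 + theta z) / (1 - theta z). *)
Lemma normc_cayley (R : rcfType) (a : R[i]) : a != 0 ->
  normc ((2 - a) / a) ^+ 2 = 1 - 4 * (complex.Re a - 1) / normc a ^+ 2.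
Proof.
move=> a0.
have na0 : normc a != 0 by apply: contra a0 => /eqP/eq0_normc ->.
rewrite normcM normcV exprMn exprVn; apply: (mulIf (expf_neq0 2 na0)).
rewrite mulrBl !divfK ?expf_neq0 // mul1r !normc_sqr; case: a {a0 na0} => x y /=.
ring.
Qed.

Lemma MCS_amplification_le (R : realType) (theta z0 : R) (z1 z2 : R[i]) :
  2^-1 <= theta <= 1 -> complex.Re z1 <= 0 -> complex.Re z2 <= 0 ->
  z0 ^+ 2 <= 4 * complex.Re z1 * complex.Re z2 ->
  MCS_p theta%:C%C z1 z2 != 0 /\ normc (MCS_S theta%:C%C z0%:C%C z1 z2) <= 1.
Proof.
move=> /andP[th1 th2] z1_le z2_le z0_le.
have th0 : 0 < theta by lra.
pose a := 1 - theta%:C%C * z1; pose b := 1 - theta%:C%C * z2.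
have ReE (z : R[i]) :
    complex.Re (1 - theta%:C%C * z) = 1 - theta * complex.Re z.
  by case: z => x y /=; rewrite mul0r subr0.
have Re_gt0 (z : R[i]) : complex.Re z <= 0 -> 0 < complex.Re (1 - theta%:C%C * z).
  by move=> z_le; rewrite ReE; have := mulr_ge0_le0 (ltW th0) z_le; lra.
have neq0 (z : R[i]) : 0 < complex.Re z -> z != 0.
  by apply: contraTneq => ->; rewrite ltxx.
have a0 : a != 0 by apply/neq0/Re_gt0.
have b0 : b != 0 by apply/neq0/Re_gt0.
split; first by rewrite /MCS_p mulf_neq0.
pose al := (2 - a) / a; pose be := (2 - b) / b.
pose e := (2 * theta * z0)%:C%C / (a * b).
have thC0 : theta%:C%C != 0 :> R[i] by rewrite fmorph_eq0 gt_eqF.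
have -> : MCS_S theta%:C%C z0%:C%C z1 z2 =
  1 - (theta^-1)%:C%C / 2 * (1 - al * be - e) * (1 + (1 - al * be) / 2)
    + (theta^-1)%:C%C ^+ 2 / 8 * (1 - al * be - e) ^+ 2.
  rewrite /MCS_S /MCS_p /e /al /be !rmorphM fmorphV rmorph_nat.
  (* Expressing [z1] and [z2] through [a] and [b] leaves a rational identity with denominators [a],
     [b] and theta only. *)
  rewrite (_ : z1 = (1 - a) / theta%:C%C); last by rewrite /a; field.
  rewrite (_ : z2 = (1 - b) / theta%:C%C); last by rewrite /b; field.
  by field; rewrite a0 b0 thC0.
apply: MCS_disk_le.
  by rewrite invf_ge1 // th2 -(invrK 2) lef_pV2 // posrE invr_gt0.
have na : 0 < normc a ^+ 2.
  by rewrite exprn_gt0 // lt_def normc_ge0 andbT; apply: contra a0 => /eqP/eq0_normc ->.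
have nb : 0 < normc b ^+ 2.
  by rewrite exprn_gt0 // lt_def normc_ge0 andbT; apply: contra b0 => /eqP/eq0_normc ->.
have ale := normc_cayley _ _ a0; have bee := normc_cayley _ _ b0.
have aRe : complex.Re a - 1 = - theta * complex.Re z1 by rewrite ReE; ring.
have bRe : complex.Re b - 1 = - theta * complex.Re z2 by rewrite ReE; ring.
have pa : 0 <= 4 * (complex.Re a - 1) / normc a ^+ 2.
  rewrite divr_ge0 ?(ltW na) // mulr_ge0 // aRe mulNr oppr_ge0.
  exact: mulr_ge0_le0 (ltW th0) z1_le.
have pb : 0 <= 4 * (complex.Re b - 1) / normc b ^+ 2.
  rewrite divr_ge0 ?(ltW nb) // mulr_ge0 // bRe mulNr oppr_ge0.
  exact: mulr_ge0_le0 (ltW th0) z2_le.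
(* The hypothesis on [z0] becomes |e|^2 <= (1 - |al|^2) (1 - |be|^2). *)
have ee : normc e ^+ 2 <=
    (4 * (complex.Re a - 1) / normc a ^+ 2) * (4 * (complex.Re b - 1) / normc b ^+ 2).
  rewrite /e normcM normcV normcM exprMn exprVn exprMn mulf_div aRe bRe.
  rewrite ler_pM2r ?invr_gt0 ?(mulr_gt0 na nb) // normc_sqr /= expr0n addr0.
  rewrite -subr_ge0; have -> : forall u v : R, 4 * (- theta * u) * (4 * (- theta * v))
    - (2 * theta * z0) ^+ 2 = 4 * theta ^+ 2 * (4 * u * v - z0 ^+ 2).
    by move=> u v; ring.
  by apply: mulr_ge0; rewrite ?subr_ge0 // mulr_ge0 ?sqr_ge0.
rewrite -/al in ale; rewrite -/be in bee; rewrite (normcM al).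
have al0 := normc_ge0 _ al; have be0 := normc_ge0 _ be.
move: (normc al) (normc be) al0 be0 ale bee => x y x0 y0 xE yE.
have x1 : x <= 1 by rewrite -(@expr_le1 _ 2) // xE; lra.
have y1 : y <= 1 by rewrite -(@expr_le1 _ 2) // yE; lra.
rewrite addrC -lerBrDr -ler_sqr ?nnegrE ?normc_ge0 ?subr_ge0 ?mulr_ile1 //.
apply: le_trans ee _.
(* (1 - x^2)(1 - y^2) <= (1 - x y)^2 *)
rewrite (_ : 4 * _ / _ = 1 - x ^+ 2); last by rewrite xE; ring.
rewrite (_ : 4 * _ / _ = 1 - y ^+ 2); last by rewrite yE; ring.
rewrite -subr_ge0 (_ : _ - _ = (x - y) ^+ 2) ?sqr_ge0 //; ring.
Qed.

(** * The quadratic form of the diffusion matrix *)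

Lemma psd_discriminant (R : realType) (D : 'M[R]_2) : psd D ->
  [/\ 0 <= D 0 0, 0 <= D 1 1 & (D 0 1 + D 1 0) ^+ 2 <= 4 * D 0 0 * D 1 1].
Proof.
move=> hD.
have q (x y : R) : 0 <= D 0 0 * x ^+ 2 + (D 0 1 + D 1 0) * (x * y) + D 1 1 * y ^+ 2.
  have := hD (\col_i if i == 0 then x else y).
  rewrite !mxE !big_ord_recl big_ord0 !mxE !big_ord_recl !big_ord0 !mxE /=.
  rewrite (_ : lift 0 0 = 1 :> 'I_2); last exact/val_inj.
  rewrite !addr0 => /le_trans; apply; rewrite le_eqVlt; apply/orP; left.
  by apply/eqP; ring.
move: (D 0 0) (D 1 1) (D 0 1 + D 1 0) q => p r s q.
have p0 : 0 <= p by have := q 1 0; lra.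
have r0 : 0 <= r by have := q 0 1; lra.
split => //.
(* For p = 0 the form at (-(r + 1), s) equals -s^2, which forces s = 0. *)
have [pz|pn] := eqVneq p 0; first by have := q (- (r + 1)) s; rewrite pz; lra.
have pp : 0 < p by rewrite lt_def pn.
rewrite -subr_ge0 -(pmulr_rge0 _ pp).
(* The form at (-s, 2p) equals p (4 p r - s^2). *)
by have := q (- s) (2 * p); lra.
Qed.

(** * Fourier modes under cyclic shifts *)

Lemma cisD (R : realType) (x y : R) : cis (x + y) = cis x * cis y.
Proof. by rewrite /cis cosD sinD; congr Complex; ring. Qed.

Lemma cis0 (R : realType) : cis (0 : R) = 1.
Proof. by rewrite /cis cos0 sin0. Qed.

Lemma cis_2piz (R : realType) (n : int) : cis (2 * pi * n%:~R : R) = 1.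
Proof.
have c1 : cis (2 * pi : R) = 1.
  by rewrite /cis mulr_natl cos2pi sin2pi.
have cn (m : nat) : cis (2 * pi * m%:R : R) = 1.
  elim: m => [|m IH]; first by rewrite mulr0 cis0.
  by rewrite -[m.+1%:R]natr1 mulrDr mulr1 cisD IH c1 mulr1.
case: n => m; first exact: cn.
rewrite NegzE -[LHS]mulr1 -{1}(cn m.+1) -cisD -[RHS]cis0; congr cis.
by rewrite rmorphN /=; ring.
Qed.

Lemma cis_neq0 (R : realType) (x : R) : cis x != 0.
Proof.
apply/eqP => x0; have := cisD _ x (- x).
by rewrite x0 mul0r subrr cis0 => /eqP; rewrite oner_eq0.
Qed.

(** The angle by which the grid shift [s] rotates the mode (k, l). *)
Definition phase (R : realType) (m1 m2 : nat) (k : 'I_m1) (l : 'I_m2)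
    (s : int * int) : R :=
  2 * pi * (k%:R * s.1%:~R / m1%:R + l%:R * s.2%:~R / m2%:R).

(** Wrapping around the grid changes the index by a multiple q m, hence the angle by 2 pi k q, which
    [cis] does not see. *)
Lemma cis_pshift (R : realType) (m : nat) (k i : 'I_m) (s : int) :
  cis (2 * pi * (k%:R * (pshift s i)%:R / m%:R) : R)
  = cis (2 * pi * (k%:R * s%:~R / m%:R)) * cis (2 * pi * (k%:R * i%:R / m%:R)).
Proof.
have m0 : m%:R != 0 :> R by rewrite pnatr_eq0 -lt0n (leq_trans _ (ltn_ord i)).
pose q := ((i%:Z + s) %/ m%:Z)%Z.
have : (pshift s i)%:Z = i%:Z + s - q * m%:Z.
  by rewrite pshiftE {2}(divz_eq (i%:Z + s) m%:Z) -/q; ring.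
move=> /(congr1 (fun z : int => z%:~R : R)).
rewrite !(rmorphD, rmorphB, rmorphM) /= -!pmulrn => ->.
rewrite -cisD -[RHS]mulr1 -(cis_2piz _ (- (k%:Z * q))) -cisD; congr cis.
by rewrite !(rmorphN, rmorphM) /=; field.
Qed.

Lemma fourier_pshift (R : realType) (m1 m2 : nat) (k : 'I_m1) (l : 'I_m2)
    (s : int * int) i j :
  fourier R k l (pshift s.1 i) (pshift s.2 j)
  = cis (phase R m1 m2 k l s) * fourier R k l i j.
Proof.
rewrite !mxE /phase !(mulrDr (2 * pi)) !cisD !cis_pshift; ring.
Qed.

Lemma fourier_neq0 (R : realType) (m1 m2 : nat) (k : 'I_m1) (l : 'I_m2) :
  fourier R k l != 0.
Proof.
apply/eqP => /matrixP /(_ k l) /eqP; rewrite !mxE.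
by rewrite (negPf (cis_neq0 _ _)).
Qed.

(** * Finite difference operators and their symbols *)

(** A list of coefficients with grid shifts is a common form for all the discretizations. The ring
    is general because the operator acts on real grid functions and on complex modes. *)
Definition fdop (K : pzRingType) (m1 m2 : nat) (L : seq (K * (int * int)))
    (u : 'M[K]_(m1, m2)) : 'M[K]_(m1, m2) :=
  \matrix_(i, j) \sum_(q <- L) q.1 * u (pshift q.2.1 i) (pshift q.2.2 j).

Lemma fdop_linear (K : comPzRingType) m1 m2 (L : seq (K * (int * int))) :
  linear (@fdop K m1 m2 L).
Proof.
move=> a u v; apply/matrixP => i j; rewrite !mxE mulr_sumr -big_split /=.
by apply: eq_bigr => q _; rewrite !mxE; ring.
Qed.

HB.instance Definition _ (K : comPzRingType) m1 m2 L :=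
  GRing.isLinear.Build K 'M[K]_(m1, m2) 'M[K]_(m1, m2) *:%R (fdop K m1 m2 L)
    (fdop_linear K m1 m2 L).

Definition symbol (R : realType) (m1 m2 : nat) (k : 'I_m1) (l : 'I_m2)
    (L : seq (R * (int * int))) : R[i] :=
  \sum_(q <- L) q.1%:C%C * cis (phase R m1 m2 k l q.2).

(** Each shift multiplies the mode by its phase factor, so the operator multiplies it by the
    weighted sum of these factors. *)
Lemma fdop_mode (R : realType) (m1 m2 : nat) (k : 'I_m1) (l : 'I_m2)
    (L : seq (R * (int * int))) :
  mode_eigenvalue (lin_mx (fdop R m1 m2 L)) k l (symbol R m1 m2 k l L).
Proof.
rewrite /mode_eigenvalue /complexify.
pose LC := [seq (q.1%:C%C, q.2) | q <- L].
rewrite (@map_lin_mx _ _ (real_complex R) _ _ _ _ _ (fdop R[i] m1 m2 LC)); last first.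
  move=> A; apply/matrixP => i j; rewrite !mxE rmorph_sum big_map /=.
  by apply: eq_bigr => q _; rewrite rmorphM !mxE.
rewrite mul_vec_lin -linearZ; congr mxvec; apply/matrixP => i j.
rewrite [in LHS]mxE big_map [in RHS]mxE /symbol mulr_suml.
by apply: eq_bigr => q _; rewrite fourier_pshift mulrA.
Qed.

(** A mode is a nonzero vector, so its eigenvalue is unique. This turns the eigenvalues in the
    definition of stability into explicit symbols. *)
Lemma fdop_mode_eq (R : realType) (m1 m2 : nat) (k : 'I_m1) (l : 'I_m2)
    (L : seq (R * (int * int))) (lam : R[i]) :
  mode_eigenvalue (lin_mx (fdop R m1 m2 L)) k l lam ->
  lam = symbol R m1 m2 k l L.
Proof.
rewrite /mode_eigenvalue fdop_mode => /eqP; rewrite -subr_eq0 -scalerBl.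
rewrite scaler_eq0 mxvec_eq0 (negPf (fourier_neq0 _ _ _ _ _)) orbF subr_eq0.
by move=> /eqP.
Qed.

(** * Symbols of the mixed, diffusion and convection terms *)

Definition mode_angle (R : realType) (m : nat) (k : 'I_m) : R :=
  2 * pi * (k%:R / m%:R).

Lemma phaseE (R : realType) (m1 m2 : nat) (k : 'I_m1) (l : 'I_m2) (s : int * int) :
  phase R m1 m2 k l s = s.1%:~R * mode_angle R m1 k + s.2%:~R * mode_angle R m2 l.
Proof. rewrite /phase /mode_angle; ring. Qed.

(** [kappa] stands for (d12 + d21) / (4 dx dy), with dx and dy the mesh widths. *)
Definition mixed_stencil (R : realType) (beta kappa : R) : seq (R * (int * int)) :=
  [:: (kappa * (1 + beta), (1, 1)); (kappa * (1 + beta), (-1, -1));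
      (- kappa * (1 - beta), (-1, 1)); (- kappa * (1 - beta), (1, -1));
      (kappa * (4 * beta), (0, 0));
      (- kappa * (2 * beta), (1, 0)); (- kappa * (2 * beta), (0, 1));
      (- kappa * (2 * beta), (-1, 0)); (- kappa * (2 * beta), (0, -1))].

Lemma A0_fdop (R : realType) (beta : R) (D : 'M[R]_2) (m1 m2 : nat) :
  A0 beta D m1 m2 =
  lin_mx (fdop R m1 m2 (mixed_stencil R beta
    ((D 0 1 + D 1 0) / (4 * mesh R m1 * mesh R m2)))).
Proof.
congr lin_mx; apply/funext => u; apply/matrixP => i j.
by rewrite !mxE !big_cons big_nil /=; ring.
Qed.

(** Opposite shifts carry equal weights, so imaginary parts cancel; this is why z0 is real. *)
Lemma mixed_symbol (R : realType) (m1 m2 : nat) (k : 'I_m1) (l : 'I_m2)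
    (beta kappa : R) (x := mode_angle R m1 k) (y := mode_angle R m2 l) :
  symbol R m1 m2 k l (mixed_stencil R beta kappa) =
  (4 * kappa * (beta * (1 - cos x) * (1 - cos y) - sin x * sin y))%:C%C.
Proof.
rewrite /symbol !big_cons big_nil /= !phaseE /= -/x -/y.
rewrite !(mulrN1z, mulr1z, mulr0z, mulN1r, mul1r, mul0r, addr0, add0r) /cis.
rewrite !(cosD, sinD, cosN, sinN, cos0, sin0).
by apply/eqP; rewrite eq_complex /=; apply/andP; split; apply/eqP; ring.
Qed.

Definition convection_stencil (R : realType) (e : int -> int * int) (c : R)
    (w : seq (int * R)) : seq (R * (int * int)) :=
  [seq (c * p.2, e p.1) | p <- w].

(* e embeds the one-dimensional shifts into the grid, along x or along y. *)
Definition directional_stencil (R : realType) (e : int -> int * int) (d h c : R)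
    (w : seq (int * R)) : seq (R * (int * int)) :=
  [:: (d / h ^+ 2, e 1); (- (2 * d) / h ^+ 2, e 0); (d / h ^+ 2, e (-1))]
  ++ convection_stencil R e c w.

Definition shift_x (s : int) : int * int := (s, 0).
Definition shift_y (s : int) : int * int := (0, s).

Lemma convection_x_fdop (R : realType) (c : 'cV[R]_2) (wx : stencil R) (m1 m2 : nat) :
  convection_x c wx m1 m2 =
  lin_mx (fdop R m1 m2 (convection_stencil R shift_x (c 0 0) (wx m1))).
Proof.
congr lin_mx; apply/funext => u; apply/matrixP => i j.
by rewrite !mxE big_map mulr_sumr; apply: eq_bigr => p _; rewrite mulrA.
Qed.

Lemma convection_y_fdop (R : realType) (c : 'cV[R]_2) (wy : stencil R) (m1 m2 : nat) :
  convection_y c wy m1 m2 =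
  lin_mx (fdop R m1 m2 (convection_stencil R shift_y (c 1 0) (wy m2))).
Proof.
congr lin_mx; apply/funext => u; apply/matrixP => i j.
by rewrite !mxE big_map mulr_sumr; apply: eq_bigr => p _; rewrite mulrA.
Qed.

Lemma A1_fdop (R : realType) (c : 'cV[R]_2) (D : 'M[R]_2) (wx : stencil R)
    (m1 m2 : nat) :
  A1 c D wx m1 m2 = lin_mx (fdop R m1 m2
    (directional_stencil R shift_x (D 0 0) (mesh R m1) (c 0 0) (wx m1))).
Proof.
congr lin_mx; apply/funext => u; apply/matrixP => i j.
rewrite !mxE big_cat /= !big_cons big_nil /= big_map mulr_sumr.
congr (_ + _); first by ring.
by apply: eq_bigr => p _; rewrite mulrA.
Qed.

Lemma A2_fdop (R : realType) (c : 'cV[R]_2) (D : 'M[R]_2) (wy : stencil R)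
    (m1 m2 : nat) :
  A2 c D wy m1 m2 = lin_mx (fdop R m1 m2
    (directional_stencil R shift_y (D 1 1) (mesh R m2) (c 1 0) (wy m2))).
Proof.
congr lin_mx; apply/funext => u; apply/matrixP => i j.
rewrite !mxE big_cat /= !big_cons big_nil /= big_map mulr_sumr.
congr (_ + _); first by ring.
by apply: eq_bigr => p _; rewrite mulrA.
Qed.

(** Diffusion contributes an explicit real term, while the convection symbol stays abstract so that
    any stable discretization fits. *)
Lemma Re_directional_symbol (R : realType) (m1 m2 : nat) (k : 'I_m1) (l : 'I_m2)
    (e : int -> int * int) (x d h c : R) (w : seq (int * R)) :
  (forall s, phase R m1 m2 k l (e s) = s%:~R * x) ->
  complex.Re (symbol R m1 m2 k l (directional_stencil R e d h c w)) =
  complex.Re (symbol R m1 m2 k l (convection_stencil R e c w))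
    - 2 * (d * h^-1 ^+ 2 * (1 - cos x)).
Proof.
move=> ex; rewrite /symbol big_cat raddfD /= addrC; congr (_ + _).
rewrite !big_cons big_nil /= !ex !(mulrN1z, mulr1z, mulr0z, mulN1r, mul1r, mul0r).
by rewrite cosN cos0 exprVn; ring.
Qed.

(** Opposite shifts carry opposite weights, so the symbol is purely imaginary. *)
Lemma Re_central_symbol (R : realType) (m1 m2 : nat) (k : 'I_m1) (l : 'I_m2)
    (e : int -> int * int) (x c : R) (m : nat) :
  (forall s, phase R m1 m2 k l (e s) = s%:~R * x) ->
  complex.Re (symbol R m1 m2 k l (convection_stencil R e c (central R m))) = 0.
Proof.
move=> ex; rewrite /symbol !big_cons big_nil /= !ex.
by rewrite !(mulrN1z, mulr1z, mulN1r, mul1r) cosN; ring.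
Qed.

(** The symbol is an eigenvalue of the matrix, with the Fourier mode as eigenvector. *)
Lemma Re_symbol_le0 (R : realType) (L : forall m1 m2 : nat, seq (R * (int * int)))
    (C : forall m1 m2 : nat, 'M[R]_(m1 * m2)) :
  (forall m1 m2, C m1 m2 = lin_mx (fdop R m1 m2 (L m1 m2))) ->
  stable_discretization C ->
  forall m1 m2 (k : 'I_m1) (l : 'I_m2),
    complex.Re (symbol R m1 m2 k l (L m1 m2)) <= 0.
Proof.
move=> CE stC m1 m2 k l.
(* The indices [k] and [l] witness that the grid is nonempty. *)
apply: (stC m1 m2); [exact: leq_trans (ltn_ord k)|exact: leq_trans (ltn_ord l)|].
apply/eigenvalueP; exists (mxvec (fourier R k l)).
  by rewrite CE; apply: fdop_mode.
by rewrite mxvec_eq0 fourier_neq0.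
Qed.

(** * Von Neumann stability of the split scheme *)

(** The slack is (1 - cos x) (1 - cos y) times a sum of (1 - beta) (1 - cos (x - y)), (1 + beta) (1
    - cos (x + y)) and (1 - beta^2) (1 - cos x) (1 - cos y), all nonnegative for |beta| <= 1. *)
Lemma mixed_symbol_le (R : realType) (beta x y : R) : -1 <= beta <= 1 ->
  (beta * (1 - cos x) * (1 - cos y) - sin x * sin y) ^+ 2
  <= 4 * (1 - cos x) * (1 - cos y).
Proof.
move=> /andP[b1 b2].
have bb : 0 <= (1 - beta) * (1 + beta) by rewrite mulr_ge0; lra.
have sx : sin x ^+ 2 = 1 - cos x ^+ 2 by have := cos2Dsin2 x; lra.
have sy : sin y ^+ 2 = 1 - cos y ^+ 2 by have := cos2Dsin2 y; lra.
have x0 : 0 <= 1 - cos x by rewrite subr_ge0 cos_le1.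
have y0 : 0 <= 1 - cos y by rewrite subr_ge0 cos_le1.
have dD : 0 <= (1 - beta) * (1 - cos (x - y)).
  by rewrite mulr_ge0 // subr_ge0 // cos_le1.
have dB : 0 <= (1 + beta) * (1 - cos (x + y)).
  by rewrite mulr_ge0 ?subr_ge0 ?cos_le1 //; lra.
rewrite cosB in dD; rewrite cosD in dB.
have -> : (beta * (1 - cos x) * (1 - cos y) - sin x * sin y) ^+ 2 =
  (beta * (1 - cos x) * (1 - cos y)) ^+ 2
  - 2 * beta * (1 - cos x) * (1 - cos y) * (sin x * sin y)
  + sin x ^+ 2 * sin y ^+ 2 by ring.
rewrite sx sy.
move: (cos x) (cos y) (sin x * sin y) x0 y0 dD dB => u v w x0 y0 dD dB.
rewrite -subr_ge0.
have -> : 4 * (1 - u) * (1 - v) - ((beta * (1 - u) * (1 - v)) ^+ 2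
    - 2 * beta * (1 - u) * (1 - v) * w + (1 - u ^+ 2) * (1 - v ^+ 2)) =
  (1 - u) * (1 - v) * ((1 - beta) * (1 - (u * v + w)) + (1 + beta) * (1 - (u * v - w))
    + (1 - beta) * (1 + beta) * ((1 - u) * (1 - v))) by ring.
by do ?[done | apply: mulr_ge0 | apply: addr_ge0].
Qed.

(** Stability is reduced to the sign of the real parts of the convection symbols, so that one
    argument serves central and general discretizations. *)
Lemma MCS_stable (R : realType) (c : 'cV[R]_2) (D : 'M[R]_2) (beta theta : R)
    (wx wy : stencil R) :
  psd D -> -1 <= beta <= 1 -> 2^-1 <= theta <= 1 ->
  (forall m1 m2 (k : 'I_m1) (l : 'I_m2), complex.Re (symbol R m1 m2 k l
     (convection_stencil R shift_x (c 0 0) (wx m1))) <= 0) ->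
  (forall m1 m2 (k : 'I_m1) (l : 'I_m2), complex.Re (symbol R m1 m2 k l
     (convection_stencil R shift_y (c 1 0) (wy m2))) <= 0) ->
  MCS_unconditionally_stable theta (A0 beta D) (A1 c D wx) (A2 c D wy).
Proof.
move=> hD hbeta htheta hx hy m1 m2 _ _ dt dt0 k l l0 l1 l2.
rewrite A0_fdop A1_fdop A2_fdop.
move=> /fdop_mode_eq -> /fdop_mode_eq El1 /fdop_mode_eq El2.
rewrite mixed_symbol -rmorphM.
have [d00 d11 disc] := psd_discriminant _ _ hD.
pose x := mode_angle R m1 k; pose y := mode_angle R m2 l.
have xE s : phase R m1 m2 k l (shift_x s) = s%:~R * x.
  by rewrite phaseE /= mul0r addr0.
have yE s : phase R m1 m2 k l (shift_y s) = s%:~R * y.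
  by rewrite phaseE /= mul0r add0r.
have := Re_directional_symbol _ _ _ _ _ _ _ (D 0 0) (mesh R m1) (c 0 0) (wx m1) xE.
have := Re_directional_symbol _ _ _ _ _ _ _ (D 1 1) (mesh R m2) (c 1 0) (wy m2) yE.
rewrite -El1 -El2 => Re2 Re1 {El1 El2}.
have {hx} r1_le := hx m1 m2 k l; have {hy} r2_le := hy m1 m2 k l.
have mixed := mixed_symbol_le _ _ x y hbeta.
rewrite -/x -/y; set T := beta * _ * _ - _ in mixed *.
rewrite invfM invfM.
move: (mesh R m1)^-1 (mesh R m2)^-1 Re1 Re2 => M N Re1 Re2.
have x0 : 0 <= 1 - cos x by rewrite subr_ge0 cos_le1.
have y0 : 0 <= 1 - cos y by rewrite subr_ge0 cos_le1.
(* [- 2 * P] and [- 2 * Q] are the diffusion parts of Re l1 and Re l2; convection can only lower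
   these real parts. *)
pose P := D 0 0 * M ^+ 2 * (1 - cos x); pose Q := D 1 1 * N ^+ 2 * (1 - cos y).
have P0 : 0 <= P by rewrite mulr_ge0 // mulr_ge0 ?sqr_ge0.
have Q0 : 0 <= Q by rewrite mulr_ge0 // mulr_ge0 ?sqr_ge0.
have ReM (z : R[i]) : complex.Re (dt%:C%C * z) = dt * complex.Re z.
  by case: z => u v /=; rewrite mul0r subr0.
have Re1_le : complex.Re l1 <= 0 by rewrite Re1 -/P; lra.
have Re2_le : complex.Re l2 <= 0 by rewrite Re2 -/Q; lra.
have [] := MCS_amplification_le R theta
  (dt * (4 * ((D 0 1 + D 1 0) * (4^-1 * M * N)) * T)) (dt%:C%C * l1) (dt%:C%C * l2)
  htheta.
- by rewrite ReM mulr_ge0_le0 // ltW.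
- by rewrite ReM mulr_ge0_le0 // ltW.
- rewrite !ReM.
  have -> : 4 * (dt * complex.Re l1) * (dt * complex.Re l2) =
    dt ^+ 2 * (4 * ((- complex.Re l1) * (- complex.Re l2))) by ring.
  rewrite exprMn ler_wpM2l ?sqr_ge0 //.
  have -> : (4 * ((D 0 1 + D 1 0) * (4^-1 * M * N)) * T) ^+ 2 =
    (M * N) ^+ 2 * ((D 0 1 + D 1 0) ^+ 2 * T ^+ 2) by field.
  (* The discriminant bound for [D] multiplied by the trigonometric bound for [T]; after scaling,
     the right-hand side is 4 (2P) (2Q) <= 4 Re l1 Re l2. *)
  have step1 : (D 0 1 + D 1 0) ^+ 2 * T ^+ 2 <=
      4 * D 0 0 * D 1 1 * (4 * (1 - cos x) * (1 - cos y)).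
    by apply: ler_pM; rewrite ?sqr_ge0.
  apply: le_trans (ler_wpM2l (sqr_ge0 _) step1) _.
  have -> : (M * N) ^+ 2 * (4 * D 0 0 * D 1 1 * (4 * (1 - cos x) * (1 - cos y))) =
    4 * ((2 * P) * (2 * Q)) by rewrite /P /Q; ring.
  rewrite ler_wpM2l //; by apply: ler_pM; rewrite ?Re1 ?Re2 -/P -/Q; lra.
move=> p0 S1; split=> //.
(* The norm on R[i] is [normc] embedded as a complex number, and the order there compares real parts
   when imaginary parts agree. *)
by rewrite [`|_|]/(_%:C%C) lecE /= eqxx.
Qed.

Theorem theorem1 (R : realType) (c : 'cV[R]_2) (D : 'M[R]_2) (beta theta : R)
    (hD : psd D) (hbeta : -1 <= beta <= 1) (htheta : 2^-1 <= theta <= 1) :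
  MCS_unconditionally_stable theta
    (A0 beta D) (A1 c D (@central R)) (A2 c D (@central R)) /\
  (forall wx wy : stencil R,
     stable_discretization (convection_x c wx) ->
     stable_discretization (convection_y c wy) ->
     MCS_unconditionally_stable theta (A0 beta D) (A1 c D wx) (A2 c D wy)).
Proof.
(* Convection symbols have zero real part for central differences, and nonpositive real part by
   assumption otherwise. *)
split=> [|wx wy stx sty]; apply: MCS_stable => // m1 m2 k l.
- rewrite (Re_central_symbol _ _ _ _ _ _ (mode_angle R m1 k)) // => s.
  by rewrite phaseE /= mul0r addr0.
- rewrite (Re_central_symbol _ _ _ _ _ _ (mode_angle R m2 l)) // => s.
  by rewrite phaseE /= mul0r add0r.
- exact: (Re_symbol_le0 _
    (fun m1 _ => convection_stencil R shift_x (c 0 0) (wx m1)) _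
    (convection_x_fdop _ c wx) stx).
- exact: (Re_symbol_le0 _
    (fun _ m2 => convection_stencil R shift_y (c 1 0) (wy m2)) _
    (convection_y_fdop _ c wy) sty).
Qed.
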